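(* Let $M\in\mathbb{R}^{n\times n}$. Then $M$ is an element of $RV_n$ if and only if there are vectors $a,b\in\mathbb{R}^\nu$ such that $$M=\mathcal{X}_n\begin{pmatrix}\mathcal{O}_\nu&1_\nu a^T\\ b1_\nu^T&\mathcal{O}_\nu\end{pmatrix}\mathcal{X}_n$$ if $n=2\nu$ is even, and $$M=\mathcal{X}_n\begin{pmatrix}\mathcal{O}_\nu&0_\nu&\sqrt2\,1_\nu a^T\\ 0_\nu^T&0&a^T\\ \sqrt2\,b1_\nu^T&b&\mathcal{O}_\nu\end{pmatrix}\mathcal{X}_n$$ if $n=2\nu+1$ is odd.
   Context: $RV_n=R_n\cap V_n$ (weightless reversible squares), where $R_n$ is the space of matrices $M\in\mathbb{R}^{n\times n}$ such that $M_{i,j}+M_{i,n+1-j}=M_{i,k}+M_{i,n+1-k}$ and $M_{i,j}+M_{n+1-i,j}=M_{k,j}+M_{n+1-k,j}$ for all $i,j,k\in\{1,\dots,n\}$, and $V_n$ is the space of matrices $M\in\mathbb{R}^{n\times n}$ such that $M_{i,j}+M_{k,l}=M_{i,l}+M_{k,j}$ for all $i,j,k,l\in\{1,\dots,n\}$ and $\sum_{i,j=1}^nM_{i,j}=0$. $1_\nu$ and $0_\nu$ are the all-ones and null column vectors in $\mathbb{R}^\nu$; $\mathcal{O}_\nu$, $\mathcal{I}_\nu$ are the $\nu\times\nu$ null and unit matrices; $\mathcal{J}_\nu=(\delta_{i,\nu+1-j})_{i,j=1}^\nu$ (ones on the antidiagonal, zeros elsewhere); and $$\mathcal{X}_n=\frac1{\sqrt2}\begin{pmatrix}\mathcal{I}_\nu&\mathcal{J}_\nu\\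 \mathcal{J}_\nu&-\mathcal{I}_\nu\end{pmatrix}\ (n=2\nu),\qquad \mathcal{X}_n=\begin{pmatrix}\frac1{\sqrt2}\mathcal{I}_\nu&0_\nu&\frac1{\sqrt2}\mathcal{J}_\nu\\ 0_\nu^T&1&0_\nu^T\\ \frac1{\sqrt2}\mathcal{J}_\nu&0_\nu&-\frac1{\sqrt2}\mathcal{I}_\nu\end{pmatrix}\ (n=2\nu+1).$$ *)

(* Defs.v *)
From mathcomp Require Import all_boot all_order all_algebra.
From mathcomp Require Import classical_sets reals.

Set Implicit Arguments.
Unset Strict Implicit.
Unset Printing Implicit Defensive.

Import GRing.Theory.
Local Open Scope classical_set_scope.
Local Open Scope ring_scope.

(* Indices range over {0, ..., n-1}, so the reflection i |-> n+1-i of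
   {1, ..., n} is [rev_ord]. *)
Definition reversible (R : realType) (n : nat) : set 'M[R]_n :=
  [set M | (forall i j k : 'I_n,
              M i j + M i (rev_ord j) = M i k + M i (rev_ord k))
        /\ (forall i j k : 'I_n,
              M i j + M (rev_ord i) j = M k j + M (rev_ord k) j)].

Definition vertex_cross (R : realType) (n : nat) : set 'M[R]_n :=
  [set M | (forall i j k l : 'I_n, M i j + M k l = M i l + M k j)
        /\ \sum_(i < n) \sum_(j < n) M i j = 0].

Definition weightless_reversible (R : realType) (n : nat) : set 'M[R]_n :=
  @reversible R n `&` @vertex_cross R n.

Definition ones (R : realType) (nu : nat) : 'cV[R]_nu := const_mx 1.

Definition exchange_mx (R : realType) (nu : nat) : 'M[R]_nu :=
  \matrix_(i, j) (i == rev_ord j)%:R.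

Definition block3_mx (R : realType) (m1 m2 m3 n1 n2 n3 : nat)
    (A11 : 'M[R]_(m1, n1)) (A12 : 'M[R]_(m1, n2)) (A13 : 'M[R]_(m1, n3))
    (A21 : 'M[R]_(m2, n1)) (A22 : 'M[R]_(m2, n2)) (A23 : 'M[R]_(m2, n3))
    (A31 : 'M[R]_(m3, n1)) (A32 : 'M[R]_(m3, n2)) (A33 : 'M[R]_(m3, n3)) :
    'M[R]_(m1 + (m2 + m3), n1 + (n2 + n3)) :=
  block_mx A11 (row_mx A12 A13)
           (col_mx A21 A31) (block_mx A22 A23 A32 A33).

Definition X_even (R : realType) (nu : nat) : 'M[R]_(nu + nu) :=
  (Num.sqrt 2)^-1 *: block_mx 1%:M            (exchange_mx R nu)
                              (exchange_mx R nu) (- 1%:M).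

Definition X_odd (R : realType) (nu : nat) : 'M[R]_(nu + (1 + nu)) :=
  let s : R := (Num.sqrt 2)^-1 in
  block3_mx (s *: 1%:M)               0    (s *: exchange_mx R nu)
            0                         1%:M 0
            (s *: exchange_mx R nu)   0    (- (s *: 1%:M)).

(* Main.v *)
(** The all-ones vector is a multiple of [X w] for the vector [w] heading the
    middle factor [w (0,a)^T + (0,b) w^T], while the vectors [X (0,b)] are
    exactly those that change sign under reversal of their entries.  So both
    formulas say that [M i j = p i + q j] with [p] and [q] antisymmetric, and
    this characterizes weightless reversible squares: reversibility makes
    [M i j + M i' j'] (with [i'], [j'] the reversed indices) constant, the
    weight condition makes it zero, and then [p i = (M i j + M i j') / 2] and
    [q j = (M i j + M i' j) / 2] do not depend on [j], resp. [i]. *)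
Require Import Defs.
From mathcomp Require Import all_boot all_order all_algebra.
From mathcomp Require Import classical_sets reals.
From mathcomp Require Import ring lra zify.
Import Order.TTheory GRing.Theory Num.Theory.
Local Open Scope ring_scope.

Definition antisymmetric_cv {R : realType} {n : nat} (p : 'cV[R]_n) : Prop :=
  forall i, p (rev_ord i) 0 = - p i 0.

Lemma sum_rev_ord {R : realType} {n : nat} (F : 'I_n -> R) :
  \sum_i F (rev_ord i) = \sum_i F i.
Proof. by rewrite [RHS](reindex_inj rev_ord_inj). Qed.

Lemma sum_antisymmetric_cv {R : realType} {n : nat} {p : 'cV[R]_n} :
  antisymmetric_cv p -> \sum_i p i 0 = 0.
Proof.
move=> hp; have := sum_rev_ord (fun i => p i 0).
under eq_bigr => i _ do rewrite hp.
rewrite sumrN; lra.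
Qed.

(** Once these pair sums are known to be constant, adding them over all positions counts every entry
    of [M] twice, so [n ^ 2] times the constant is twice the weight, that is, zero. *)
Lemma weightless_opposite {R : realType} {n : nat} {M : 'M[R]_n} :
  weightless_reversible M -> forall i j, M i j + M (rev_ord i) (rev_ord j) = 0.
Proof.
move=> [[hr hc] [hv hs]].
(* The sum over the four reflections of a position does not depend on the position, by [hr] and
   [hc]. By [hv] its two diagonal pairs have equal sums, so each is half of it. *)
have hS i j k l : M i j + M (rev_ord i) (rev_ord j) =
                  M k l + M (rev_ord k) (rev_ord l).
  have := hr i j l; have := hr (rev_ord i) j l.
  have := hc i l k; have := hc i (rev_ord l) k.
  have := hv i j (rev_ord i) (rev_ord j).
  have := hv k l (rev_ord k) (rev_ord l).
  lra.
move=> i j.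
have : \sum_k \sum_l (M k l + M (rev_ord k) (rev_ord l)) = 0.
  under eq_bigr => k _ do rewrite big_split /= sum_rev_ord.
  by rewrite big_split /= (sum_rev_ord (fun k => \sum_l M k l)) hs addr0.
under eq_bigr => k _ do under eq_bigr => l _ do rewrite (hS k l i j).
(* Cancelling the factors [n] needs [n] nonzero, which the index [i] witnesses. *)
have n_gt0 : (0 < n)%N := leq_ltn_trans (leq0n i) (ltn_ord i).
by rewrite !sumr_const card_ord => /eqP; rewrite !mulrn_eq0 gtn_eqF // => /eqP.
Qed.

Lemma weightless_reversibleP {R : realType} {n : nat} (M : 'M[R]_n) :
  weightless_reversible M <->
  exists p q : 'cV[R]_n, [/\ antisymmetric_cv p, antisymmetric_cv q &
    M = p *m (ones R n)^T + ones R n *m q^T].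
Proof.
have entry (p q : 'cV[R]_n) i j :
    (p *m (ones R n)^T + ones R n *m q^T) i j = p i 0 + q j 0.
  by rewrite !mxE !big_ord1 !mxE mulr1 mul1r.
split=> [hM|[p [q [hp hq ->]]]].
  have h0 := weightless_opposite hM; case: hM => [[hr hc] [hv _]].
  (* Any column could serve in row [i], by [hr]; taking column [i] avoids fixing one, which would be
     impossible for [n = 0]. The same holds for [q]. *)
  exists (\col_i ((M i i + M i (rev_ord i)) / 2)).
  exists (\col_j ((M j j + M (rev_ord j) j) / 2)); split.
  - move=> i; rewrite !mxE rev_ordK.
    have := h0 i i; have := h0 i (rev_ord i); rewrite rev_ordK; lra.
  - move=> j; rewrite !mxE rev_ordK.
    have := h0 j j; have := h0 j (rev_ord j); rewrite rev_ordK; lra.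
  - apply/matrixP=> i j; rewrite entry !mxE.
    (* Moving both witnesses to position [i, j] gives [M i j] plus half the sum of its two mirror
       images, and [hv] with [h0] makes that sum vanish. *)
    have := hr i i j; have := hc j j i.
    have := h0 i j; have := hv i j (rev_ord i) (rev_ord j); lra.
split; split.
- by move=> i j k; rewrite !entry !hq; ring.
- by move=> i j k; rewrite !entry !hp; ring.
- by move=> i j k l; rewrite !entry; ring.
- under eq_bigr => i _ do under eq_bigr => j _ do rewrite entry.
  under eq_bigr => i _ do rewrite big_split /= (sum_antisymmetric_cv hq)
    sumr_const addr0.
  by rewrite sumrMnl (sum_antisymmetric_cv hp) mul0rn.
Qed.

Lemma exchange_mxE {R : realType} {nu : nat} (b : 'cV[R]_nu) i j :
  (exchange_mx R nu *m b) i j = b (rev_ord i) j.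
Proof.
rewrite mxE (bigD1 (rev_ord i)) //= mxE rev_ordK eqxx mul1r big1 ?addr0 //.
move=> k hk; rewrite mxE; case: eqP => [ik|_]; last by rewrite mul0r.
by rewrite ik rev_ordK eqxx in hk.
Qed.

Lemma tr_exchange_mx {R : realType} {nu : nat} :
  (exchange_mx R nu)^T = exchange_mx R nu.
Proof.
by apply/matrixP=> i j; rewrite !mxE -(inj_eq rev_ord_inj) rev_ordK eq_sym.
Qed.

Lemma exchange_mx_ones {R : realType} {nu : nat} :
  exchange_mx R nu *m ones R nu = ones R nu.
Proof. by apply/matrixP=> i j; rewrite exchange_mxE !mxE. Qed.

Lemma antisymmetric_even {R : realType} {nu : nat} (p : 'cV[R]_(nu + nu)) :
  antisymmetric_cv p <->
  exists b, p = col_mx (exchange_mx R nu) (- 1%:M) *m b.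
Proof.
have revl (i : 'I_nu) : rev_ord (lshift nu i) = rshift nu (rev_ord i).
  by apply: val_inj => /=; have := ltn_ord i; lia.
split=> [hp|[b ->] i].
  exists (- dsubmx p); rewrite mul_col_mx mulNmx mul1mx opprK.
  rewrite -[LHS]vsubmxK; congr col_mx; apply/matrixP=> i j.
  by rewrite exchange_mxE !mxE ord1 -revl hp opprK.
rewrite mul_col_mx mulNmx mul1mx -(splitK i); case: (split i) => k /=.
  by rewrite revl col_mxEu col_mxEd exchange_mxE !mxE.
rewrite -[k in LHS]rev_ordK -revl rev_ordK col_mxEu col_mxEd exchange_mxE.
by rewrite !mxE rev_ordK opprK.
Qed.

(** The lower part is free and determines the upper one, as in the even case; the central index is
    its own reflection, which forces a zero there. *)
Lemma antisymmetric_odd {R : realType} {nu : nat}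
    (p : 'cV[R]_(nu + (1 + nu))) :
  antisymmetric_cv p <->
  exists b, p = col_mx (exchange_mx R nu) (col_mx 0 (- 1%:M)) *m b.
Proof.
have revl (i : 'I_nu) :
    rev_ord (lshift (1 + nu) i) = rshift nu (rshift 1 (rev_ord i)).
  by apply: val_inj => /=; have := ltn_ord i; lia.
have revm (i : 'I_1) :
    rev_ord (rshift nu (lshift nu i)) = rshift nu (lshift nu i).
  by apply: val_inj => /=; rewrite ord1 /=; lia.
split=> [hp|[b ->] i].
  exists (- dsubmx (dsubmx p)).
  rewrite !mul_col_mx mul0mx mulNmx mul1mx opprK.
  rewrite -[LHS]vsubmxK -[dsubmx p in LHS]vsubmxK.
  congr col_mx; last congr col_mx; apply/matrixP=> i j.
  - by rewrite exchange_mxE !mxE ord1 -revl hp opprK.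
  - have := hp (rshift nu (lshift nu i)); rewrite revm !mxE !ord1; lra.
rewrite !mul_col_mx mul0mx mulNmx mul1mx -(splitK i).
case: (split i) => k /=;
  last (rewrite -(splitK k); case: (split k) => {}k /=).
- by rewrite revl col_mxEu !col_mxEd exchange_mxE !mxE.
- by rewrite revm col_mxEd col_mxEu mxE oppr0.
rewrite -[k in LHS]rev_ordK -revl rev_ordK col_mxEu !col_mxEd exchange_mxE.
by rewrite !mxE rev_ordK opprK.
Qed.

(** Common core of both parities: [w] heads the middle factor and [E] places a vector of length [nu]
    in the last block. As [X] is symmetric, conjugation just applies [X] to every vector of the two
    rank-one terms. *)
Lemma weightless_reversible_conj {R : realType} {n nu : nat}
    (X : 'M[R]_n) (w : 'cV[R]_n) (E U : 'M[R]_(n, nu)) (c d : R) :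
  X^T = X -> c != 0 -> d != 0 ->
  X *m w = c *: ones R n -> X *m E = d *: U ->
  (forall p, antisymmetric_cv p <-> exists b, p = U *m b) ->
  forall M, weightless_reversible M <->
    exists a b : 'cV[R]_nu,
      M = X *m (w *m (E *m a)^T + (E *m b) *m w^T) *m X.
Proof.
move=> XT c0 d0 Xw XE hU M.
have trX (v : 'cV[R]_n) : v^T *m X = (X *m v)^T by rewrite trmx_mul XT.
have conjE a b : X *m (w *m (E *m a)^T + (E *m b) *m w^T) *m X =
    (U *m ((c * d) *: b)) *m (ones R n)^T +
    ones R n *m (U *m ((c * d) *: a))^T.
  rewrite mulmxDr mulmxDl addrC -!mulmxA !trX !mulmxA XE Xw.
  by rewrite !linearZ /= -!scalemxAl !linearZ /= !scalerA [d * c]mulrC.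
rewrite weightless_reversibleP; split=> [[p [q []]]|[a [b ->]]].
  move=> /hU [b ->] /hU [a ->] ->.
  (* This undoes the scaling by [c * d] in [conjE]; [b] comes from [p] and [a] from [q]. *)
  exists ((c * d)^-1 *: a), ((c * d)^-1 *: b).
  by rewrite conjE !scalerA mulfV ?mulf_neq0 // !scale1r.
exists (U *m ((c * d) *: b)), (U *m ((c * d) *: a)).
by split; rewrite ?conjE //; apply/hU; eexists.
Qed.

Lemma sqrt2_neq0 {R : realType} : Num.sqrt 2 != 0 :> R.
Proof. by rewrite sqrtr_eq0 -ltNge ltr0n. Qed.

Lemma ones_col_mx {R : realType} {m n : nat} :
  ones R (m + n) = col_mx (ones R m) (ones R n).
Proof. by rewrite /ones col_mx_const. Qed.

Theorem theorem16 (R : realType) (nu : nat) :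
  (forall M : 'M[R]_(nu + nu),
     weightless_reversible M <->
     exists a b : 'cV[R]_nu,
       M = X_even R nu
           *m block_mx 0                  (ones R nu *m a^T)
                       (b *m (ones R nu)^T) 0
           *m X_even R nu)
  /\
  (forall M : 'M[R]_(nu + (1 + nu)),
     weightless_reversible M <->
     exists a b : 'cV[R]_nu,
       M = X_odd R nu
           *m block3_mx
                0                                   0 (Num.sqrt 2 *: (ones R nu *m a^T))
                0                                   0 (a^T)
                (Num.sqrt 2 *: (b *m (ones R nu)^T)) b 0
           *m X_odd R nu).
Proof.
have s0 := @sqrt2_neq0 R.
have si0 : (Num.sqrt 2)^-1 != 0 :> R by rewrite invr_eq0.
split=> M.
- rewrite (@weightless_reversible_conj _ _ nu (X_even R nu)
    (col_mx (ones R nu) 0) (col_mx 0 1%:M)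
    (col_mx (exchange_mx R nu) (- 1%:M)) (Num.sqrt 2)^-1 (Num.sqrt 2)^-1) //.
  + suff K (a b : 'cV[R]_nu) : col_mx (ones R nu) 0 *m (col_mx 0 1%:M *m a)^T +
        col_mx 0 1%:M *m b *m (col_mx (ones R nu) 0)^T =
      block_mx 0 (ones R nu *m a^T) (b *m (ones R nu)^T) 0.
      by split=> -[a [b ->]]; exists a, b; rewrite K.
    rewrite !mul_col_mx !mul0mx !mul1mx !tr_col_mx !trmx0 !mul_mx_row !mulmx0.
    by rewrite add_col_mx add0r addr0.
  + by rewrite linearZ /= tr_block_mx linearN /= trmx1 tr_exchange_mx.
  + rewrite -scalemxAl mul_block_col !mulmx0 !addr0 mul1mx exchange_mx_ones.
    by rewrite ones_col_mx.
  + by rewrite -scalemxAl mul_block_col !mulmx0 !add0r !mulmx1.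
  + exact: antisymmetric_even.
(* Here [c = 1]: the central row of [X_odd] keeps the central 1 of [w], and the factor [Num.sqrt 2]
   in its upper block cancels the normalization of the outer rows. *)
- rewrite (@weightless_reversible_conj _ _ nu (X_odd R nu)
    (col_mx (Num.sqrt 2 *: ones R nu) (col_mx (ones R 1) 0))
    (col_mx 0 (col_mx 0 1%:M))
    (col_mx (exchange_mx R nu) (col_mx 0 (- 1%:M))) 1 (Num.sqrt 2)^-1) //.
  + suff K (a b : 'cV[R]_nu) : col_mx (Num.sqrt 2 *: ones R nu) (col_mx (ones R 1) 0) *m
          (col_mx 0 (col_mx 0 1%:M) *m a)^T +
        col_mx 0 (col_mx 0 1%:M) *m b *m
          (col_mx (Num.sqrt 2 *: ones R nu) (col_mx (ones R 1) 0))^T =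
      block3_mx 0 0 (Num.sqrt 2 *: (ones R nu *m a^T)) 0 0 a^T
        (Num.sqrt 2 *: (b *m (ones R nu)^T)) b 0.
      by split=> -[a [b ->]]; exists a, b; rewrite K.
    (* Seen as an identity matrix, the central block of [w] disappears from products, leaving the
       bare [a^T] and [b] of the statement. *)
    have ones1 : ones R 1 = 1%:M.
      by apply/matrixP=> i j; rewrite !mxE !ord1.
    rewrite ones1 !mul_col_mx !mul0mx !mul1mx !tr_col_mx !trmx0 trmx1.
    rewrite !mul_mx_row !mulmx0 !mulmx1 !add_col_mx !add0r !addr0.
    rewrite linearZ /= -scalemxAl -scalemxAr.
    by rewrite /block3_mx !block_mxEv -block_mxEh block_mxEv.
  + rewrite /X_odd /block3_mx /= !tr_block_mx tr_row_mx tr_col_mx.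
    by rewrite !linearN /= !linearZ /= !trmx0 !trmx1 tr_exchange_mx.
  + exact: oner_neq0.
  + rewrite /X_odd /block3_mx /= !mul_block_col mul_row_col mul_col_mx.
    rewrite add_col_mx !mul0mx !mulmx0 !addr0 !add0r -!scalemxAl !mul1mx -scalemxAr.
    rewrite exchange_mx_ones !scalerA mulVf // !scale1r.
    by rewrite !ones_col_mx.
  + rewrite /X_odd /block3_mx /= !mul_block_col mul_row_col mul_col_mx.
    rewrite add_col_mx !mul0mx !mulmx0 !addr0 !add0r !mulmx1.
    by rewrite !scale_col_mx scaler0 scalerN.
  + exact: antisymmetric_odd.
Qed.
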